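(* Assume that: (U1) $A(s)$ is compact for every $s\in S$ and the correspondence $s\mapsto A(s)$ is upper semicontinuous; (U2) $u$ is upper semicontinuous on $\mathbb K$; (U3) $q$ is Feller, i.e. $(s,a)\mapsto\int_S v(s')q(ds'|s,a)$ is continuous on $\mathbb K$ for each bounded continuous $v:S\to\mathbb R$. Consider the Bellman equation $$v(s)=\sup_{a\in A(s)}\left((1-\beta)u(s,a)^p+\beta\left[\frac1r\ln\int_S e^{rv(s')}q(ds'|s,a)\right]^p\right)^{1/p}\quad\text{for all } s\in S.$$ Then: (a) the Bellman equation has a solution $v^*\in\widehat{\mathcal U}$; (b) $v^*$ is the unique solution to the Bellman equation in the class $\widehat{\mathcal A}$.
   Context: Model. $S$ (states) and $A$ (actions) are Borel spaces, i.e. non-empty Borel subsets of complete separable metric spaces. $\mathbb K\subset S\times A$ is a non-empty Borel set such that each section $A(s)=\{a\in A:(s,a)\in\mathbb K\}$, $s\in S$, is non-empty. $q$ is a Borel measurable transition probability from $\mathbb K$ to $S$. $u:\mathbb K\to\mathbb R$ is Borel measurable with $b_0\le u(s,a)\le b_1$ for all $(s,a)\in\mathbb K$, where $b_1>b_0>0$ are constants. $\beta\in[0,1)$, $r<0$, and $p<1$, $p\ne0$ are fixed real parameters. Constants. $0<\epsilon<B$ are fixed constants chosen as follows: if $p<0$, then $\epsilon\le b_0$ and $B\ge(1-\beta)^{1/p}b_1$; if $p\in(0,1)$, then $\epsilon\le(1-\beta)^{1/p}b_0$ and $B\ge b_1$. Function classes. A subset of a Borel space $Y$ is analytic if it is the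 projection onto $Y$ of a Borel subset of $Y\times Y$. A function $g:Y\to\mathbb R$ is upper semianalytic if $\{y:g(y)>c\}$ is analytic for every $c\in\mathbb R$ (such functions are universally measurable; integrals are taken with respect to completed measures). $\widehat{\mathcal A}$ is the set of all upper semianalytic functions $v:S\to[\epsilon,B]$; $\widehat{\mathcal U}$ is the set of all upper semicontinuous functions $v:S\to[\epsilon,B]$. A correspondence $\varphi$ from $S$ to a separable metric space $Z$ is upper semicontinuous if $\{s\in S:\varphi(s)\cap D\ne\emptyset\}$ is closed for each closed $D\subset Z$. *)

(* Defs.v *)
From HB Require Import structures.
From mathcomp Require Import all_boot all_order all_algebra.
From mathcomp Require Import all_classical all_reals all_analysis.
From mathcomp Require Import measurable_realfun.

Set Implicit Arguments.
Unset Strict Implicit.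
Unset Printing Implicit Defensive.

Import Order.TTheory GRing.Theory Num.Theory.
Import numFieldNormedType.Exports.

Local Open Scope classical_set_scope.
Local Open Scope ring_scope.

Definition borel_set (T : topologicalType) (E : set T) : Prop :=
  <<s (@open T) >> E.

(* T with its Borel sigma-algebra; the library's measurable types are pointed. *)
Notation borel T := (g_sigma_algebraType (@open T)).

Definition complete_space (X : uniformType) : Prop :=
  forall F : set_system X, ProperFilter F -> cauchy F -> exists x : X, F --> x.

Definition separable_space (X : topologicalType) : Prop :=
  exists2 D : set X, countable D & dense D.

(* T is, up to homeomorphism, a Borel subset of a complete separable metric
   space X: f is a topological embedding of T onto that subset. Non-emptiness
   is provided by the pointed structure of the types this is applied to. *)
Definition borel_space (R : realType) (T : topologicalType) : Prop :=
  exists (X : metricType R) (f : T -> X),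
    [/\ complete_space X, separable_space X, injective f,
        (forall U : set T, open U <-> exists2 V, open V & f @^-1` V = U) &
        borel_set (range f)].

Definition analytic (Y : topologicalType) (E : set Y) : Prop :=
  exists2 D : set (Y * Y), borel_set D & E = fst @` D.

Definition upper_semianalytic (R : realType) (Y : topologicalType)
    (g : Y -> R) : Prop :=
  forall c : R, analytic [set y | g y > c].

(* Upper semicontinuity on a subset D is the instance X := subspace D. *)
Definition upper_semicontinuous (R : realType) (X : topologicalType)
    (f : X -> R) : Prop :=
  forall (x : X) (c : R), f x < c -> \forall y \near x, f y < c.

Definition usc_correspondence (S Z : topologicalType) (phi : S -> set Z) : Prop :=
  forall D : set Z, closed D -> closed [set s | phi s `&` D !=set0].

Definition usa_class (R : realType) (S : topologicalType) (eps B : R)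
    (v : S -> R) : Prop :=
  upper_semianalytic v /\ forall s, eps <= v s <= B.

Definition usc_class (R : realType) (S : topologicalType) (eps B : R)
    (v : S -> R) : Prop :=
  upper_semicontinuous v /\ forall s, eps <= v s <= B.

Section model.
Context (R : realType) (S A : ptopologicalType).
Variables (K : set (S * A)) (q : S * A -> probability (borel S) R).

(* q is total, but only its restriction to K is constrained or used. *)
Definition transition_probability : Prop :=
  forall E : set (borel S), measurable E ->
    measurable_fun (K : set (borel (S * A)%type))
      (fun x : borel (S * A)%type => q x E).

Definition feller : Prop :=
  forall v : S -> R, continuous v -> bounded_fun v ->
    {within K, continuous (fun x : S * A => \int[q x]_(s in setT) v s)}.

Variables (u : S * A -> R) (beta r p : R).

(* The integral is with respect to the completion of q (s, a), as v need only
   be universally measurable. *)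
Definition certainty_equivalent (v : S -> R) (x : S * A) : R :=
  r^-1 * ln (\int[@completed_measure_extension _ _ _ (q x)]_(s in setT)
               expR (r * v s)).

Definition bellman_equation (v : S -> R) : Prop :=
  forall s : S, v s =
    sup [set ((1 - beta) * u (s, a) `^ p
              + beta * certainty_equivalent v (s, a) `^ p) `^ p^-1
        | a in xsection K s].

End model.

(* Main.v *)
(** The Bellman operator is monotone and, because the aggregator is homogeneous
    and the certainty equivalent satisfies CE (l v) >= l CE v for 0 < l <= 1
    (Jensen), it satisfies Op (l v) >= m(l) Op v.  Here m(l) is the p-th power
    mean of 1 and l with weights 1 - th and th, and th < 1 bounds the share of
    the continuation value.  Since m(l)^p - 1 = th (l^p - 1), iterating m from
    eps / B converges to 1, which gives both uniqueness and the fact that the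
    infimum of the decreasing iterates of Op from the constant B is a fixed
    point.  Uniqueness needs no measurability: the integral of a nonnegative
    function is always its lower integral, for which monotonicity and Jensen's
    inequality still hold.

    The iterates are upper semicontinuous.  As r < 0, exp (r v) is lower
    semicontinuous when v is upper semicontinuous, hence an increasing limit of
    its Lipschitz regularizations, and the Feller property makes its integral
    lower semicontinuous.  Compactness of the sections and upper semicontinuity
    of the correspondence then pass upper semicontinuity to the supremum. *)

Require Import Defs.
From mathcomp Require Import all_boot all_order all_algebra.
From mathcomp Require Import all_classical all_reals all_analysis.
From mathcomp Require Import measurable_realfun.
From mathcomp Require Import finmap lra ring.
Import Order.TTheory GRing.Theory Num.Theory.
Import numFieldNormedType.Exports.
Local Open Scope classical_set_scope.
Local Open Scope ring_scope.

Set Implicit Arguments.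
Unset Strict Implicit.
Unset Printing Implicit Defensive.

(** * Real powers and the sign of the exponent *)

Section powR_monotone.
Context {R : realType}.
Implicit Types p x y : R.

Lemma powRK p x : p != 0 -> 0 < x -> (x `^ p) `^ p^-1 = x.
Proof. by move=> p0 x0; rewrite -powRrM mulfV// powRr1// ltW. Qed.

Lemma powRVK p x : p != 0 -> 0 < x -> (x `^ p^-1) `^ p = x.
Proof. by move=> p0 x0; rewrite -powRrM mulVf// powRr1// ltW. Qed.

Lemma le_powR_pos p x y : 0 < p -> 0 < x -> x <= y -> x `^ p <= y `^ p.
Proof.
move=> p0 x0 xy; apply: ge0_ler_powR => //; rewrite ?nnegrE ltW//.
exact: lt_le_trans xy.
Qed.

Lemma le_powR_neg p x y : p < 0 -> 0 < x -> x <= y -> y `^ p <= x `^ p.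
Proof.
move=> p0 x0 xy; rewrite -[p]opprK !(powRN _ (- p)) lef_pV2 ?posrE ?powR_gt0//.
  by apply: le_powR_pos => //; rewrite oppr_gt0.
exact: lt_le_trans xy.
Qed.

(** Here [x] and [y] play the role of [p]-th powers: their order reverses when [p < 0] and the root
    reverses it back, so one conclusion serves both signs. *)
Lemma le_powRV p x y : p != 0 -> 0 < x -> 0 < y ->
  (0 < p -> x <= y) -> (p < 0 -> y <= x) -> x `^ p^-1 <= y `^ p^-1.
Proof.
move=> p0 x0 y0 pos neg; have [pn|pp|p00] := ltgtP p 0.
- by apply: le_powR_neg; rewrite ?invr_lt0// neg.
- by apply: le_powR_pos; rewrite ?invr_gt0// pos.
- by rewrite p00 eqxx in p0.
Qed.

End powR_monotone.

(** * The CES aggregator, a weighted [p]-th power mean *)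

Section ces.
Context {R : realType}.
Implicit Types b p u z t l : R.

Definition ces b p u z : R := ((1 - b) * u `^ p + b * z `^ p) `^ p^-1.

Lemma convex_gt0 b x y : 0 <= b < 1 -> 0 < x -> 0 < y ->
  0 < (1 - b) * x + b * y.
Proof.
move=> /andP[b0 b1] x0 y0; apply: ltr_pwDl.
  by rewrite mulr_gt0// subr_gt0.
by rewrite mulr_ge0// ltW.
Qed.

Lemma ces_gt0 b p u z : 0 <= b < 1 -> 0 < u -> 0 < z -> 0 < ces b p u z.
Proof. by move=> b01 u0 z0; rewrite powR_gt0// convex_gt0// powR_gt0. Qed.

Lemma ces_powR b p u z : p != 0 -> 0 <= b < 1 -> 0 < u -> 0 < z ->
  ces b p u z `^ p = (1 - b) * u `^ p + b * z `^ p.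
Proof. by move=> p0 b01 u0 z0; rewrite powRVK// convex_gt0// powR_gt0. Qed.

Lemma cesxx b p x : p != 0 -> 0 < x -> ces b p x x = x.
Proof. by move=> p0 x0; rewrite /ces -mulrDl subrK mul1r powRK. Qed.

Lemma ces_le b p u u' z z' : p != 0 -> 0 <= b < 1 -> 0 < u -> 0 < z ->
  u <= u' -> z <= z' -> ces b p u z <= ces b p u' z'.
Proof.
move=> p0 b01 u0 z0 uu zz.
have u'0 : 0 < u' by exact: lt_le_trans uu.
have z'0 : 0 < z' by exact: lt_le_trans zz.
have /andP[b0 b1] := b01.
by apply: le_powRV; rewrite ?convex_gt0 ?powR_gt0// => ps;
   apply: lerD; apply: ler_wpM2l; rewrite ?subr_ge0 ?(ltW b1)//;
   first [exact: le_powR_pos | exact: le_powR_neg].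
Qed.

Lemma cesM b p t u z : p != 0 -> 0 <= b < 1 -> 0 < t -> 0 < u -> 0 < z ->
  ces b p (t * u) (t * z) = t * ces b p u z.
Proof.
move=> p0 b01 t0 u0 z0; rewrite /ces !powRM ?ltW//.
rewrite mulrCA (mulrCA b) -mulrDr powRM ?powR_ge0// ?powRK//.
by rewrite ltW// convex_gt0// powR_gt0.
Qed.

(* [th] bounds the share of the continuation value in the aggregate. *)
Lemma ces_scale b th p u z l : p != 0 -> 0 <= b < 1 -> 0 <= th < 1 ->
  0 < u -> 0 < z -> 0 < l -> l <= 1 ->
  b * z `^ p <= th * ((1 - b) * u `^ p + b * z `^ p) ->
  ces th p 1 l * ces b p u z <= ces b p u (l * z).
Proof.
move=> p0 b01 th01 u0 z0 l0 l1 hth.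
rewrite /ces -powRM; last 2 first.
- by rewrite ltW// convex_gt0// powR_gt0.
- by rewrite ltW// convex_gt0// powR_gt0.
have key : (1 - th) * 1 `^ p + th * l `^ p = 1 + th * (l `^ p - 1).
  by rewrite powR1; ring.
apply: le_powRV => //.
- by rewrite mulr_gt0// convex_gt0// powR_gt0.
- by rewrite convex_gt0// powR_gt0// mulr_gt0.
- move=> pp; rewrite key (powRM _ (ltW l0) (ltW z0)).
  have : l `^ p <= 1 `^ p by exact: le_powR_pos.
  rewrite powR1.
  move: hth; set L := l `^ p; set U := u `^ p; set Z := z `^ p => hth L1.
  (* The difference of the two [p]-th powers is the product of [1 - L] and the slack in [hth]. For
     [p < 0] the order of the powers and the sign of the first factor both flip. *)
  rewrite -subr_ge0 [leRHS](_ : _ =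
    (1 - L) * (th * ((1 - b) * U + b * Z) - b * Z)); last by ring.
  by rewrite mulr_ge0 ?subr_ge0.
- move=> pp; rewrite key (powRM _ (ltW l0) (ltW z0)).
  have : 1 `^ p <= l `^ p by exact: le_powR_neg.
  rewrite powR1.
  move: hth; set L := l `^ p; set U := u `^ p; set Z := z `^ p => hth L1.
  rewrite -subr_ge0 [leRHS](_ : _ =
    (L - 1) * (th * ((1 - b) * U + b * Z) - b * Z)); last by ring.
  by rewrite mulr_ge0 ?subr_ge0.
Qed.

Lemma powR_itv_bounds p a c : 0 < a -> a <= c ->
  exists m M : R, [/\ 0 < m, 0 < M & forall x, a <= x <= c -> m <= x `^ p <= M].
Proof.
move=> a0 ac; have c0 : 0 < c by exact: lt_le_trans ac.
have [pn|pp|->] := ltgtP p 0.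
- exists (c `^ p), (a `^ p); split; rewrite ?powR_gt0// => x /andP[ax xc].
  by rewrite !le_powR_neg//; exact: lt_le_trans ax.
- exists (a `^ p), (c `^ p); split; rewrite ?powR_gt0// => x /andP[ax xc].
  by rewrite !le_powR_pos//; exact: lt_le_trans ax.
- by exists 1, 1; split => // x _; rewrite powRr0 lexx.
Qed.

(** The share grows with [z ^ p] and falls with [u ^ p], so its value at an upper bound [M] of the
    former and a lower bound [m] of the latter dominates; it is below 1 because
    [(1 - b) * m > 0]. *)
Lemma ces_share_bound b p a c a' c' : 0 <= b < 1 ->
  0 < a -> a <= c -> 0 < a' -> a' <= c' ->
  exists2 th, 0 <= th < 1 &
    forall u z, a <= u <= c -> a' <= z <= c' ->
      b * z `^ p <= th * ((1 - b) * u `^ p + b * z `^ p).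
Proof.
move=> /andP[b0 b1] a0 ac a'0 ac'.
have [m [M1 [m0 _ hm]]] := powR_itv_bounds p a0 ac.
have [m1 [M [_ M0 hM]]] := powR_itv_bounds p a'0 ac'.
have b1' : 0 < 1 - b by rewrite subr_gt0.
have D0 : 0 < (1 - b) * m + b * M.
  by rewrite ltr_pwDl ?mulr_gt0// mulr_ge0// ltW.
exists (b * M / ((1 - b) * m + b * M)).
  rewrite divr_ge0 ?mulr_ge0 ?(ltW M0) ?(ltW D0)//= ltr_pdivrMr// mul1r.
  by rewrite ltrDr mulr_gt0.
move=> u z /hm/andP[mu _] /hM/andP[_ zM].
rewrite mulrAC ler_pdivlMr//.
have H1 : 0 <= b * (1 - b) * M by rewrite !mulr_ge0// ltW.
have := ler_wpM2l H1 mu.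
have H2 : 0 <= b * (1 - b) * m by rewrite !mulr_ge0// ltW.
have := ler_wpM2l H2 zM.
nra.
Qed.

Lemma ces1_itv th p l : p != 0 -> 0 <= th < 1 -> 0 < l -> l <= 1 ->
  0 < ces th p 1 l /\ ces th p 1 l <= 1.
Proof.
move=> p0 th01 l0 l1; rewrite ces_gt0//; split => //.
by rewrite -[leRHS](@cesxx th _ _ p0 ltr01) ces_le.
Qed.

Definition ces_iter th p l n := iter n (ces th p 1) l.

Lemma ces_iter_itv th p l n : p != 0 -> 0 <= th < 1 -> 0 < l -> l <= 1 ->
  0 < ces_iter th p l n /\ ces_iter th p l n <= 1.
Proof.
by move=> p0 th01 l0 l1; elim: n => //= n [? ?]; exact: ces1_itv.
Qed.

(* In the variable [l `^ p] the map [ces th p 1] is affine with slope [th]. *)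
Lemma ces_iter_powR th p l n : p != 0 -> 0 <= th < 1 -> 0 < l -> l <= 1 ->
  ces_iter th p l n `^ p = 1 + th ^+ n * (l `^ p - 1).
Proof.
move=> p0 th01 l0 l1; elim: n => [|n IH]; first by rewrite expr0 /=; ring.
have [h0 h1] := ces_iter_itv n p0 th01 l0 l1.
by rewrite /= ces_powR// IH powR1 exprS; ring.
Qed.

(** The factors tend to 1. The limit is taken on [p]-th powers, where they have the closed form
    [1 + th ^ n * (l ^ p - 1)]. *)
Lemma ces_iter_le th p l x y : p != 0 -> 0 <= th < 1 -> 0 < l -> l <= 1 ->
  0 < x -> 0 < y -> (forall n, ces_iter th p l n * x <= y) -> x <= y.
Proof.
move=> p0 th01 l0 l1 x0 y0 H.
have /andP[th0 th1] := th01.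
have cvg1 : (1 + th ^+ n * (l `^ p - 1)) * x `^ p @[n --> \oo] --> x `^ p.
  rewrite -[X in _ --> X]mul1r; apply: cvgMr_tmp.
  rewrite -[X in _ --> X]addr0; apply: cvgD; first exact: cvg_cst.
  rewrite -[X in _ --> X](mul0r (l `^ p - 1)); apply: cvgMr_tmp.
  by apply: cvg_expr; rewrite ger0_norm.
have Hp n : (ces_iter th p l n * x) `^ p = (1 + th ^+ n * (l `^ p - 1)) * x `^ p.
  have [ln0 _] := ces_iter_itv n p0 th01 l0 l1.
  by rewrite (powRM _ (ltW ln0) (ltW x0)) ces_iter_powR.
have pos n : 0 < ces_iter th p l n * x.
  by have [ln0 _] := ces_iter_itv n p0 th01 l0 l1; rewrite mulr_gt0.
rewrite -(powRK p0 x0) -(powRK p0 y0).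
apply: le_powRV => //; rewrite ?powR_gt0// => ps.
- apply: (cvgr_to_le cvg1).
  by apply: nearW => n; rewrite -Hp le_powR_pos.
- apply: (cvgr_to_ge cvg1).
  by apply: nearW => n; rewrite -Hp le_powR_neg.
Qed.

End ces.

(** * Integrals of bounded, possibly non-measurable functions *)

Section lower_integral.
Context d (T : measurableType d) (R : realType) (mu : {measure set T -> \bar R}).
Import HBNNSimple.

(* Outside the measurable functions the integral of a nonnegative function is
   its lower integral, which is still monotone. *)
Lemma ge0_le_lower_integral (f g : T -> \bar R) :
  (forall x, 0 <= f x)%E -> (forall x, f x <= g x)%E ->
  (\int[mu]_x f x <= \int[mu]_x g x)%E.
Proof.
move=> f0 fg; rewrite !ge0_integralTE//; last by move=> x; exact: le_trans (fg x).
apply: ereal_sup_le => _ [h /= hf <-].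
by exists h => //= x; exact: le_trans (fg x).
Qed.

Hypothesis mu1 : mu setT = 1%E.

Lemma integral_cst1 (c : R) : (\int[mu]_x c%:E = c%:E)%E.
Proof. by rewrite integral_cst// mu1 mule1. Qed.

Section bounded.
Variables (f : T -> R) (m M : R).
Hypotheses (m0 : 0 <= m) (fmM : forall x, m <= f x <= M).

Lemma integral_itv : (m%:E <= \int[mu]_x (f x)%:E <= M%:E)%E.
Proof.
have fm x : m <= f x by have /andP[] := fmM x.
have fM x : f x <= M by have /andP[] := fmM x.
rewrite -{1}(integral_cst1 m) -{1}(integral_cst1 M).
by rewrite !ge0_le_lower_integral// => x; rewrite lee_fin ?(le_trans m0)//.
Qed.

Lemma RintegralK : ((\int[mu]_(x in setT) f x)%R%:E = \int[mu]_x (f x)%:E)%E.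
Proof.
have /andP[h1 h2] := integral_itv.
rewrite /Rintegral fineK// fin_numE; apply/andP; split; apply/eqP => h.
  by move: h1; rewrite h leeNy_eq.
by move: h2; rewrite h leye_eq.
Qed.

Lemma Rintegral_itv : m <= \int[mu]_(x in setT) f x <= M.
Proof. by rewrite -!lee_fin RintegralK integral_itv. Qed.

End bounded.

Lemma Rintegral_le (f g : T -> R) (M : R) :
  (forall x, 0 <= f x) -> (forall x, f x <= g x) -> (forall x, g x <= M) ->
  \int[mu]_(x in setT) f x <= \int[mu]_(x in setT) g x.
Proof.
move=> f0 fg gM; rewrite -lee_fin (@RintegralK f 0 M)// => [|x]; last first.
  by rewrite f0 (le_trans (fg x)).
rewrite (@RintegralK g 0 M)// => [|x]; last by rewrite (le_trans _ (fg x))/=.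
by apply: ge0_le_lower_integral => x; rewrite lee_fin.
Qed.

(** Without measurability, linearity is replaced by a comparison of minorants: a simple [h] below
    [g] yields a measurable minorant of [f] by inverting the affine map. *)
Lemma Rintegral_affine_le (f g : T -> R) (a b M : R) : 0 < a ->
  0 <= b -> (forall x, 0 <= f x <= M) -> (forall x, 0 <= g x <= a * f x + b) ->
  \int[mu]_(x in setT) g x <= a * \int[mu]_(x in setT) f x + b.
Proof.
move=> a0 b0 f0M g0.
have g0M x : 0 <= g x <= a * M + b.
  have /andP[-> /= /le_trans] := g0 x; apply.
  by rewrite lerD2r ler_pM2l//; have /andP[] := f0M x.
rewrite -lee_fin EFinD EFinM (@RintegralK g 0 (a * M + b))//.
rewrite (@RintegralK f 0 M)//.
rewrite {1}ge0_integralTE; last by move=> x; rewrite lee_fin; have /andP[] := g0 x.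
apply: ge_ereal_sup => /= _ [h hg <-].
(* The cut-off at 0 keeps [k] nonnegative and still below [f], while [h <= a * k + b] survives. *)
pose k x := Num.max ((h x - b) / a) 0.
have mh : measurable_fun setT (h : T -> R) by [].
have mk : measurable_fun setT k.
  apply: measurable_maxr => //; apply: measurable_funM => //.
  exact: measurable_funB.
have kf x : 0 <= k x <= f x.
  rewrite /k le_max lexx orbT ge_max; have /andP[-> _] := f0M x.
  rewrite andbT ler_pdivrMr// lerBlDr mulrC.
  have := hg x; rewrite lee_fin => /le_trans; apply.
  by have /andP[] := g0 x.
have hk x : h x <= a * k x + b.
  rewrite -lerBlDr -ler_pdivrMl// mulrC /k le_max lexx//.
rewrite -[sintegral mu h](_ : \int[mu]_x (h x)%:E = _)%E; last first.
  by rewrite integral_nnsfun// patch_setT.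
apply: (@le_trans _ _ (\int[mu]_x (a%:E * (k x)%:E + b%:E))%E).
  apply: ge0_le_lower_integral => x; first by rewrite lee_fin.
  by rewrite -EFinM -EFinD lee_fin.
rewrite ge0_integralD//=.
- rewrite integral_cst1 leeD2r// ge0_integralZl_EFin//.
  + rewrite lee_pmul2l ?lte_fin//.
    apply: ge0_le_lower_integral => x; rewrite lee_fin;
      by have /andP[] := kf x.
  + by move=> x _; rewrite lee_fin; have /andP[] := kf x.
  + exact/measurable_EFinP.
  + exact: ltW.
- by move=> x _; rewrite -EFinM lee_fin mulr_ge0 ?(ltW a0)//; have /andP[] := kf x.
- by apply: measurable_funeM; exact/measurable_EFinP.
Qed.

(* Jensen's inequality for the concave power [l], by integrating the tangent
   line at the mean. *)
Lemma Rintegral_powR_le (f : T -> R) (l m M : R) : 0 < l -> l <= 1 -> 0 < m ->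
  (forall x, m <= f x <= M) ->
  \int[mu]_(x in setT) (f x `^ l) <= (\int[mu]_(x in setT) f x) `^ l.
Proof.
move=> l0 l1 m0 fmM.
set c := \int[mu]_(x in setT) f x.
have c0 : 0 < c.
  by have /andP[h _] := Rintegral_itv (ltW m0) fmM; exact: lt_le_trans h.
have tangent x : f x `^ l <= l * c `^ l / c * f x + (1 - l) * c `^ l.
  have fx0 : 0 < f x by have /andP[h _] := fmM x; exact: lt_le_trans h.
  suff H : (f x / c) `^ l <= l * (f x / c) + (1 - l).
    rewrite -[f x in leLHS](divfK (lt0r_neq0 c0)) powRM; last 2 first.
    - by rewrite divr_ge0// ltW.
    - exact: ltW.
    rewrite [leRHS](_ : _ = (l * (f x / c) + (1 - l)) * c `^ l).
      by rewrite ler_pM2r// powR_gt0.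
    by field; rewrite lt0r_neq0.
  have y0 : 0 < f x / c by rewrite divr_gt0.
  set y := f x / c in y0 *.
  have S0 : 0 < l * y + (1 - l).
    by apply: ltr_pwDl; [exact: mulr_gt0|rewrite subr_ge0].
  rewrite -ler_ln ?posrE ?powR_gt0// ln_powR.
  (* With [S = l * y + (1 - l)], this bound at [y / S] and [1 / S], weighted by [l] and [1 - l],
     sums to [l * ln y - ln S <= 0]. *)
  have ln_le (t : R) : 0 < t -> ln t <= t - 1.
    by move=> t0; rewrite -[X in ln X](subrKC 1) le_ln1Dx// ltrBrDl addrN.
  have h1 := ln_le _ (divr_gt0 y0 S0).
  have h2 : ln (l * y + (1 - l))^-1 <= (l * y + (1 - l))^-1 - 1.
    by rewrite ln_le// invr_gt0.
  rewrite ln_div ?posrE// in h1; rewrite lnV ?posrE// in h2.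
  move: h1 h2; set S := l * y + (1 - l) => h1 h2.
  have h3 : l * (y / S) + (1 - l) * S^-1 = 1.
    by rewrite mulrA -mulrDl mulfV// lt0r_neq0.
  have h1' := ler_wpM2l (ltW l0) h1.
  have l1' : 0 <= 1 - l by rewrite subr_ge0.
  have h2' := ler_wpM2l l1' h2.
  lra.
have := @Rintegral_affine_le f (fun x => f x `^ l) (l * c `^ l / c)
  ((1 - l) * c `^ l) M.
rewrite -/c mulfVK ?lt0r_neq0// -mulrDl addrCA subrr addr0 mul1r; apply.
- by rewrite divr_gt0// mulr_gt0// powR_gt0.
- by rewrite mulr_ge0 ?subr_ge0// powR_ge0.
- by move=> x; have /andP[h1 ->] := fmM x; rewrite (le_trans _ h1)// ltW.
- by move=> x; rewrite powR_ge0 tangent.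
Qed.

End lower_integral.

(** * Integration against the completed measure *)

Section completion.
Context d (T : measurableType d) (R : realType) (mu : {measure set T -> \bar R}).

Lemma completed_measure_extensionE (E : set T) : measurable E ->
  @completed_measure_extension _ _ _ mu E = mu E.
Proof. by move=> mE; rewrite /completed_measure_extension/= measurable_mu_extE. Qed.

(** The identity from the Caratheodory sigma-algebra to the original one is measurable and pushes
    the completion forward to [mu]. *)
Lemma ge0_integral_completed (f : T -> \bar R) :
  (forall x, 0 <= f x)%E -> measurable_fun setT f ->
  (\int[@completed_measure_extension _ _ _ mu]_x f x = \int[mu]_x f x)%E.
Proof.
move=> f0 mf.
pose nu := @completed_measure_extension _ _ _ mu.
have mid : measurable_fun setT (idfun : caratheodory_type (mu_ext mu) -> T).
  move=> _ E mE; rewrite setTI.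
  by apply: sub_caratheodory; apply: sub_sigma_algebra.
have := @ge0_integral_pushforward _ _ _ _ _ _ mid nu setT f measurableT mf.
rewrite preimage_setT => <-; last by move=> x _; exact: f0.
apply: eq_measure_integral => E mE _; rewrite /pushforward.
exact: completed_measure_extensionE.
Qed.
End completion.

(** * Exponential certainty equivalents *)

Lemma expR_neg_itv (R : realType) (T : Type) (r : R) (v : T -> R) (a b : R) :
  r < 0 -> (forall x, a <= v x <= b) ->
  forall x, expR (r * b) <= expR (r * v x) <= expR (r * a).
Proof.
move=> r0 vab x; have /andP[av vb] := vab x.
by rewrite !ler_expR !ler_nM2l// vb av.
Qed.

Section exponential_certainty_equivalent.
Context d (T : measurableType d) (R : realType) (mu : {measure set T -> \bar R}).
Hypothesis mu1 : mu setT = 1%E.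
Variable r : R.
Hypothesis r0 : r < 0.

Definition ce (v : T -> R) : R := r^-1 * ln (\int[mu]_(x in setT) expR (r * v x)).

Lemma Rintegral_expR_gt0 (v : T -> R) (a b : R) : (forall x, a <= v x <= b) ->
  0 < \int[mu]_(x in setT) expR (r * v x).
Proof.
move=> /(expR_neg_itv r0) H; have /andP[h _] := Rintegral_itv mu1 (expR_ge0 _) H.
exact: lt_le_trans (expR_gt0 _) h.
Qed.

Lemma ce_itv (v : T -> R) (a b : R) : (forall x, a <= v x <= b) ->
  a <= ce v <= b.
Proof.
move=> vab; have I0 := Rintegral_expR_gt0 vab.
have /andP[h1 h2] := Rintegral_itv mu1 (expR_ge0 _) (expR_neg_itv r0 vab).
rewrite /ce !(mulrC r^-1) ler_ndivlMr// ler_ndivrMr//.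
rewrite -(ler_expR (ln _)) -(ler_expR _ (ln _)) !lnK ?posrE//.
by rewrite !(mulrC _ r) h1 h2.
Qed.

Lemma ce_le (v w : T -> R) (a b : R) : (forall x, a <= v x) ->
  (forall x, v x <= w x) -> (forall x, w x <= b) -> ce v <= ce w.
Proof.
move=> av vw wb.
have vab x : a <= v x <= b by rewrite av (le_trans (vw x)).
have wab x : a <= w x <= b by rewrite wb (le_trans _ (vw x)).
rewrite /ce ler_nM2l ?invr_lt0// ler_ln ?posrE ?(Rintegral_expR_gt0 vab)//;
  last exact: Rintegral_expR_gt0 wab.
apply: (@Rintegral_le _ _ _ _ mu1 _ _ (expR (r * a))) => x //.
- by rewrite ler_expR ler_nM2l.
- by have /andP[_] := expR_neg_itv r0 vab x.
Qed.

(** Since [exp (r * (l * v)) = exp (r * v) ^ l], this is Jensen's inequality for the power [l],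
    reversed by the factor [r^-1 < 0]. *)
Lemma ce_scale (v : T -> R) (a b l : R) : 0 < l -> l <= 1 ->
  (forall x, a <= v x <= b) -> l * ce v <= ce (fun x => l * v x).
Proof.
move=> l0 l1 vab.
rewrite /ce mulrCA ler_nM2l ?invr_lt0// -ln_powR ler_ln ?posrE.
- rewrite [in leLHS](_ : (fun x => expR (r * (l * v x))) =
    (fun x => expR (r * v x) `^ l)); last first.
    by apply/funext => x; rewrite -expRM mulrCA mulrC.
  exact: (Rintegral_powR_le mu1 l0 l1 (expR_gt0 (r * b)) (expR_neg_itv r0 vab)).
- apply: (@Rintegral_expR_gt0 (fun x => l * v x) (l * a) (l * b)) => x.
  by rewrite !ler_pM2l.
- by rewrite powR_gt0// (Rintegral_expR_gt0 vab).
Qed.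

End exponential_certainty_equivalent.

(** * Fixed points of a subhomogeneous operator on an order interval *)

Section order_interval_fixed_point.
Context (S : Type) (R : realType) (eps B th p : R).
Hypotheses (eps0 : 0 < eps) (epsB : eps <= B).
Hypotheses (p0 : p != 0) (th01 : 0 <= th < 1).
Variable Op : (S -> R) -> (S -> R).
Let box (v : S -> R) := forall s, eps <= v s <= B.
Hypothesis Op_box : forall v, box v -> box (Op v).
Hypothesis Op_scale : forall v w l, box v -> box w -> 0 < l -> l <= 1 ->
  (forall s, l * v s <= w s) -> forall s, ces th p 1 l * Op v s <= Op w s.

Let B0 : 0 < B. Proof. exact: lt_le_trans epsB. Qed.
Let l := eps / B.
Let l0 : 0 < l. Proof. by rewrite divr_gt0. Qed.
Let l1 : l <= 1. Proof. by rewrite ler_pdivrMr// mul1r. Qed.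
Let lam n := ces_iter th p l n.
Let lam_gt0 n : 0 < lam n. Proof. by have [] := ces_iter_itv n p0 th01 l0 l1. Qed.
Let lam_le1 n : lam n <= 1. Proof. by have [] := ces_iter_itv n p0 th01 l0 l1. Qed.

Let box_gt0 v s : box v -> 0 < v s.
Proof. by move=> /(_ s)/andP[h _]; exact: lt_le_trans h. Qed.

Let box_iter n v : box v -> box (iter n Op v).
Proof. by move=> bv; elim: n => //= n; exact: Op_box. Qed.

(** Monotonicity is the case [l = 1] of [Op_scale], as the power mean of 1 and 1 is 1. *)
Let Op_le v w : box v -> box w -> (forall s, v s <= w s) ->
  forall s, Op v s <= Op w s.
Proof.
move=> bv bw vw s; rewrite -[leLHS]mul1r -{1}(@cesxx _ th p 1)//.
by apply: Op_scale => // t; rewrite mul1r.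
Qed.

(** Any two functions of the box satisfy [(eps / B) * v <= w]; each application of [Op] then
    advances the factor from [lam n] to [lam n.+1]. *)
Let approx v w : box v -> box w ->
  forall n s, lam n * iter n Op v s <= iter n Op w s.
Proof.
move=> bv bw; elim=> [s|n IH s] /=.
  have /andP[_ vB] := bv s; have /andP[ew _] := bw s.
  by rewrite (le_trans _ ew)// /lam/= /l mulrAC ler_pdivrMr// ler_pM2l.
by apply: Op_scale => //; exact: box_iter.
Qed.

(** Fixed points equal their iterates, so [approx] gives [lam n * v <= w] for all [n]; the limit
    gives [v <= w], and the roles are symmetric. *)
Lemma box_fixed_point_unique v w : box v -> box w ->
  Op v = v -> Op w = w -> v = w.
Proof.
have le f g : box f -> box g -> Op f = f -> Op g = g -> forall s, f s <= g s.
  move=> bf bg ff gg s.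
  apply: (ces_iter_le p0 th01 l0 l1); [exact: box_gt0..|move=> n].
  have := approx bf bg n s.
  by rewrite !iter_fix.
by move=> bv bw vv ww; apply/funext => s; apply/eqP; rewrite eq_le !le.
Qed.

Let vn n := iter n Op (cst B).
Let bB : box (cst B). Proof. by move=> s; rewrite /= epsB lexx. Qed.
Let bvn n : box (vn n). Proof. exact: box_iter. Qed.
Definition iter_inf (s : S) : R := inf (range (fun n => iter n Op (cst B) s)).

Let vn_lb s : has_lbound (range (fun n => vn n s)).
Proof. by exists eps => _ [n _ <-]; have /andP[] := bvn n s. Qed.

Let iter_inf_le n s : iter_inf s <= vn n s.
Proof. by apply: ge_inf; [exact: vn_lb|exists n]. Qed.

Let le_iter_inf x s : (forall n, x <= vn n s) -> x <= iter_inf s.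
Proof.
move=> H; apply: lb_le_inf; first by exists (vn 0 s); exists 0%N.
by move=> _ [n _ <-]; exact: H.
Qed.

Lemma iter_inf_box : box iter_inf.
Proof.
move=> s; apply/andP; split.
  by apply: le_iter_inf => n; have /andP[] := bvn n s.
exact: (iter_inf_le 0%N s).
Qed.

Let vn_decr n s : vn n.+1 s <= vn n s.
Proof.
elim: n s => [|n IH] s; first by have /andP[] := bvn 1 s.
exact: (Op_le (bvn n.+1) (bvn n) IH).
Qed.

Let vn_decrD n k s : vn (n + k) s <= vn k s.
Proof. by elim: n => //= n; apply: le_trans; exact: vn_decr. Qed.

(** Comparing the starting points [B] and [vn k] by [approx] gives
    [lam n * vn n <= vn (n + k) <= vn k] for every [k]. *)
Let lam_vn n s : lam n * vn n s <= iter_inf s.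
Proof.
apply: le_iter_inf => k; apply: le_trans (vn_decrD n k s).
by rewrite /vn iterD; apply: approx => //; exact: bvn.
Qed.

(* The gap [lam n -> 1] between iterates and their infimum replaces any
   continuity of the operator along decreasing sequences. *)
Lemma iter_inf_fixed : Op iter_inf = iter_inf.
Proof.
have bi := iter_inf_box; have bOi := Op_box bi.
apply/funext => s; apply/eqP; rewrite eq_le; apply/andP; split.
  apply: le_iter_inf => -[|n]; first by have /andP[] := bOi s.
  exact: (Op_le bi (bvn n) (iter_inf_le n)).
(* For successors the chain is [lam n.+1 * iter_inf <= lam n.+1 * vn n.+1 <= Op iter_inf], the
   second step being [Op_scale] applied to [lam_vn n]. *)
apply: (ces_iter_le p0 th01 l0 l1); [exact: box_gt0..|move=> [|n]].
  exact: (approx bi bOi 0%N).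
apply: le_trans (Op_scale (bvn n) bi (lam_gt0 n) (lam_le1 n) (lam_vn n) s).
by rewrite ler_pM2l ?(iter_inf_le n.+1)//; exact: (lam_gt0 n.+1).
Qed.

End order_interval_fixed_point.

(** * The Bellman operator on the order interval *)

Section bellman_operator.
Context (R : realType) (S A : ptopologicalType).
Variables (K : set (S * A)) (q : S * A -> probability (borel S) R).
Variables (u : S * A -> R) (b0 b1 beta r p eps B : R).
Hypothesis hsec : forall s, xsection K s !=set0.
Hypothesis hb0 : 0 < b0.
Hypothesis hub : forall x, K x -> b0 <= u x <= b1.
Hypotheses (hbeta : 0 <= beta < 1) (hr : r < 0) (hp0 : p != 0).
Hypotheses (heps : 0 < eps) (epsb0 : eps <= b0) (b1B : b1 <= B).

Definition aggregate (v : S -> R) (x : S * A) : R :=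
  ces beta p (u x) (certainty_equivalent q r v x).

Definition bellman_op (v : S -> R) (s : S) : R :=
  sup [set aggregate v (s, a) | a in xsection K s].

Lemma bellman_equationE v : bellman_equation K q u beta r p v <-> bellman_op v = v.
Proof. by split=> [h|h s]; [apply/funext => s; rewrite [RHS]h|rewrite -{1}h]. Qed.

Let box (v : S -> R) := forall s, eps <= v s <= B.

Lemma completed_setT x : @completed_measure_extension _ _ _ (q x) setT = 1%E.
Proof.
by rewrite completed_measure_extensionE;
  [exact: probability_setT|exact: measurableT].
Qed.

Lemma certainty_equivalent_itv v a b x : (forall s, a <= v s <= b) ->
  a <= certainty_equivalent q r v x <= b.
Proof. exact: (ce_itv (completed_setT x)). Qed.

(** The aggregator is monotone and fixes equal arguments, and both [u] and the certainty equivalent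
    lie in [[eps, B]]. *)
Lemma aggregate_itv v x : box v -> K x -> eps <= aggregate v x <= B.
Proof.
move=> bv /hub/andP[ub0 ub1].
have /andP[cB ce] := certainty_equivalent_itv x bv.
have c0 := lt_le_trans heps cB.
have u0 := lt_le_trans hb0 ub0.
have B0 : 0 < B by exact: lt_le_trans ce.
rewrite -{1}(@cesxx _ beta p eps)// -{1}(@cesxx _ beta p B)//.
by rewrite !ces_le// ?(le_trans epsb0)// (le_trans ub1).
Qed.

Let has_sup_aggregate v s : box v ->
  has_sup [set aggregate v (s, a) | a in xsection K s].
Proof.
move=> bv; have [a Ka] := hsec s; split; first by exists (aggregate v (s, a)), a.
exists B => _ [a' Ka' <-].
by have /andP[] := aggregate_itv bv (set_mem Ka').
Qed.

Lemma aggregate_le_op v s a : box v -> K (s, a) ->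
  aggregate v (s, a) <= bellman_op v s.
Proof.
move=> bv Ka; apply: ub_le_sup; first by have [] := has_sup_aggregate s bv.
by exists a => //; exact: mem_set.
Qed.

Lemma bellman_op_le v s x :
  (forall a, K (s, a) -> aggregate v (s, a) <= x) -> bellman_op v s <= x.
Proof.
move=> H; apply: ge_sup.
  by have [a Ka] := hsec s; exists (aggregate v (s, a)), a.
by move=> _ [a Ka <-]; apply: H; exact: set_mem Ka.
Qed.

Lemma bellman_op_box v : box v -> box (bellman_op v).
Proof.
move=> bv s; have [a /set_mem Ka] := hsec s; apply/andP; split.
  apply: le_trans (aggregate_le_op bv Ka).
  by have /andP[] := aggregate_itv bv Ka.
by apply: bellman_op_le => a' Ka'; have /andP[] := aggregate_itv bv Ka'.
Qed.

Lemma bellman_op_scale th : 0 <= th < 1 ->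
  (forall y z, b0 <= y <= b1 -> eps <= z <= B ->
     beta * z `^ p <= th * ((1 - beta) * y `^ p + beta * z `^ p)) ->
  forall v w l, box v -> box w -> 0 < l -> l <= 1 ->
    (forall s, l * v s <= w s) ->
    forall s, ces th p 1 l * bellman_op v s <= bellman_op w s.
Proof.
move=> th01 hth v w l bv bw l0 l1 lvw s.
have m0 : 0 < ces th p 1 l by rewrite ces_gt0.
(* The factor is independent of the action, so it can be divided out and the supremum bounded action
   by action. *)
rewrite mulrC -ler_pdivlMr//; apply: bellman_op_le => a Ka.
rewrite ler_pdivlMr// mulrC; apply: le_trans (aggregate_le_op bw Ka).
have /andP[ub0 ub1] := hub Ka.
have u0 := lt_le_trans hb0 ub0.
have cv := certainty_equivalent_itv (s, a) bv.
have /andP[cve _] := cv.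
have c0 := lt_le_trans heps cve.
apply: (le_trans (ces_scale hp0 hbeta th01 u0 c0 l0 l1 _)).
  by apply: hth => //; rewrite ub0.
apply: ces_le => //; first by rewrite mulr_gt0.
have mu1 := completed_setT (s, a).
apply: (le_trans (ce_scale mu1 hr l0 l1 bv)).
(* The lower bound is [l * eps] because [l * v] may leave the box. *)
apply: (@ce_le _ _ _ _ mu1 _ hr (fun x => l * v x) w (l * eps) B) => // t.
- by rewrite ler_pM2l//; have /andP[] := bv t.
- by have /andP[] := bw t.
Qed.

End bellman_operator.

(** * Upper semicontinuity, suprema over sections and analytic sets *)

Section semicontinuity.
Context (R : realType).

Definition usc_on (X : topologicalType) (D : set X) (f : X -> R) :=
  forall x c, D x -> f x < c -> \forall y \near within D (nbhs x), f y < c.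

Lemma usc_on_subspace (X : topologicalType) (D : set X) (f : X -> R) :
  upper_semicontinuous (f : subspace D -> R) -> usc_on D f.
Proof.
move=> uf x c Dx fxc; have : nbhs (x : subspace D) [set y | f y < c] := uf x c fxc.
by rewrite /nbhs/= -(nbhs_subspace_in Dx).
Qed.

Lemma usc_inf (X : topologicalType) (f : nat -> X -> R) :
  (forall n, upper_semicontinuous (f n)) ->
  (forall x, has_lbound (range (fun n => f n x))) ->
  upper_semicontinuous (fun x => inf (range (fun n => f n x))).
Proof.
move=> uf lb x c fc.
have [_ [n _ <-] fnc] := inf_lt (ex_intro _ (f 0%N x) (ex_intro2 _ _ 0%N I erefl)) fc.
apply: filterS (uf n x c fnc) => y; apply: le_lt_trans.
by apply: ge_inf => //; exists n.
Qed.

Lemma usc_open (X : topologicalType) (f : X -> R) c :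
  upper_semicontinuous f -> open [set x | f x < c].
Proof. by move=> uf; rewrite openE => x /= fxc; exact: uf. Qed.

Lemma usc_measurable (X : ptopologicalType) (f : X -> R) :
  upper_semicontinuous f -> measurable_fun setT (f : borel X -> R).
Proof.
move=> uf; apply: (measurability _ (RGenInftyO.measurableE R)).
move=> _ [_ [c ->] <-]; rewrite setTI preimage_itvNyo.
by apply: sub_sigma_algebra; exact: usc_open.
Qed.

(** A tube argument, as in Berge's maximum theorem: finitely many open sets [V U] cover the section
    at [s0], nearby sections stay inside their union, and the bound holds on the intersection of the
    corresponding neighbourhoods [U]. *)
Lemma usc_section_lt (S : topologicalType) (A : ptopologicalType) (K : set (S * A))
    (f : S * A -> R) (s0 : S) (c : R) :
  compact (xsection K s0) -> usc_correspondence (fun s => xsection K s) ->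
  usc_on K f -> (forall a, K (s0, a) -> f (s0, a) < c) ->
  \forall s \near s0, forall a, K (s, a) -> f (s, a) < c.
Proof.
rewrite compact_cover => cK uK uf fc.
pose V (U : set S) := ([set a | forall s, U s -> K (s, a) -> f (s, a) < c])°.
have [||D' D'D cov] := cK (set S) (nbhs s0) V.
- by move=> U _; exact: open_interior.
- move=> a /set_mem Ka.
  have [[U W] /= [nU nW] UW] := uf (s0, a) c Ka (fc _ Ka).
  exists U => //; apply: filterS nW => a' Wa' s Us.
  exact: (UW (s, a')).
pose O := \bigcup_(U in [set` D']) V U.
have oO : open O by apply: bigcup_open => U _; exact: open_interior.
have nO : \forall s \near s0, ~ (xsection K s `&` ~` O !=set0).
  apply: open_nbhs_nbhs; split; last by move=> [a [/cov]].
  by apply: closed_openC; apply: uK; exact: open_closedC.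
have nU : \forall s \near s0, (\bigcap_(U in [set` D']) U) s.
  by apply: (@filter_bigI _ _ D' id) => U /D'D /set_mem.
near=> s => a Ka.
have [U D'U VUa] : O a.
  apply: contrapT => nVa.
  have : ~ (xsection K s `&` ~` O !=set0) by near: s.
  by apply; exists a; split => //; exact: mem_set.
apply: (interior_subset VUa) => //.
have Us : (\bigcap_(U in [set` D']) U) s by near: s.
exact: Us.
Unshelve. all: by end_near. Qed.

(** [E] is the projection of the Borel cylinder over it. *)
Lemma borel_set_analytic (X : ptopologicalType) (E : set X) :
  borel_set E -> analytic E.
Proof.
move=> bE; exists (fst @^-1` E); last first.
  apply/seteqP; split => [x Ex|_ [[x y] /= Ex <-]//].
  by exists (x, x).
have : measurable_fun setT (fst : borel (X * X)%type -> borel X).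
  move=> mT; apply: (measurability _ (erefl : @measurable _ (borel X) = _)) mT.
  move=> _ [U oU <-].
  rewrite setTI; apply: sub_sigma_algebra.
  by apply: open_comp => // x _; exact: cvg_fst.
by move=> /(_ measurableT E bE); rewrite setTI.
Qed.

Lemma usc_upper_semianalytic (X : ptopologicalType) (f : X -> R) :
  upper_semicontinuous f -> upper_semianalytic f.
Proof.
move=> /usc_measurable mf c; apply: borel_set_analytic.
have := mf measurableT `]c, +oo[%classic (measurable_itv _).
by rewrite setTI preimage_itvoy.
Qed.

End semicontinuity.

(** * Lipschitz regularization from below *)

Section lipschitz_regularization.
Context (R : realType) (S : topologicalType) (s0 : S) (X : metricType R) (e : S -> X).
Hypothesis eopen : forall U : set S, open U <-> exists2 V, open V & e @^-1` V = U.
Variables (g : S -> R) (M : R).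
Hypothesis g0M : forall s, 0 <= g s <= M.

(** The metric of [X] pulled back to [S]; by [eopen] it induces the topology of [S]. *)
Let dist s t : R := mdist (e s) (e t).

Lemma nbhs_embedding s (U : set S) : nbhs s U ->
  exists2 d : R, 0 < d & forall t, dist s t < d -> U t.
Proof.
rewrite nbhsE => -[W [/eopen[V oV <-] /= Vs] OU].
have : nbhs (e s) V by apply: open_nbhs_nbhs.
move=> /nbhs_ballP[d /= d0 dV]; exists d => // t st.
by apply: OU; apply: dV; rewrite ballEmdist.
Qed.

Lemma near_embedding s (d : R) : 0 < d -> \forall t \near s, dist s t < d.
Proof.
move=> d0; have oB : open (e @^-1` (ball (e s) d)°).
  by apply/eopen; exists ((ball (e s) d)°) => //; exact: open_interior.
have : nbhs s (e @^-1` (ball (e s) d)°).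
  apply: open_nbhs_nbhs; split => //=.
  exact: nbhsx_ballx.
apply: filterS => t /= /interior_subset; by rewrite ballEmdist.
Qed.

(** The Pasch-Hausdorff envelope: the largest [n]-Lipschitz minorant of [g]. *)
Definition lip_reg (n : nat) (s : S) : R :=
  inf (range (fun t => g t + n%:R * dist s t)).

Let lb n s : lbound (range (fun t => g t + n%:R * dist s t)) 0.
Proof.
move=> _ [t _ <-]; have /andP[g0 _] := g0M t.
by rewrite addr_ge0// mulr_ge0// mdist_ge0.
Qed.

Let has_lb n s : has_lbound (range (fun t => g t + n%:R * dist s t)).
Proof. by exists 0; exact: lb. Qed.

Let nonempty n s : range (fun t => g t + n%:R * dist s t) !=set0.
Proof. by exists (g s0 + n%:R * dist s s0), s0. Qed.

Lemma lip_reg_le n s t : lip_reg n s <= g t + n%:R * dist s t.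
Proof. by apply: ge_inf => //; exists t. Qed.

Lemma le_lip_reg n s x : (forall t, x <= g t + n%:R * dist s t) -> x <= lip_reg n s.
Proof. by move=> H; apply: lb_le_inf => // _ [t _ <-]. Qed.

Lemma lip_reg_itv n s : 0 <= lip_reg n s <= g s.
Proof.
apply/andP; split; first by apply: lb_le_inf => //; exact: lb.
by apply: le_trans (lip_reg_le n s s) _; rewrite /dist mdistxx mulr0 addr0.
Qed.

Lemma lip_reg_nd m n s : (m <= n)%N -> lip_reg m s <= lip_reg n s.
Proof.
move=> mn; apply: le_lip_reg => t; apply: le_trans (lip_reg_le m s t) _.
by rewrite lerD2l ler_wpM2r ?mdist_ge0// ler_nat.
Qed.

Lemma lip_reg_lip n s s' : lip_reg n s <= lip_reg n s' + n%:R * dist s s'.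
Proof.
rewrite -lerBlDr; apply: le_lip_reg => t; rewrite lerBlDr.
apply: le_trans (lip_reg_le n s t) _.
rewrite -addrA lerD2l -mulrDr ler_wpM2l// addrC.
exact: metric_triangle.
Qed.

Lemma lip_reg_continuous n : continuous (lip_reg n).
Proof.
move=> s; apply/cvgrPdist_lt => eps eps0.
(* The denominator [n.+1] also covers [n = 0]. *)
have d0 : 0 < eps / n.+1%:R by rewrite divr_gt0.
apply: filterS (near_embedding s d0) => t; rewrite ltr_pdivlMr// => st.
have st' : n%:R * dist s t < eps.
  apply: le_lt_trans st; rewrite mulrC ler_wpM2l ?mdist_ge0// ler_nat.
  exact: leqnSn.
have h1 := lip_reg_lip n s t; have h2 := lip_reg_lip n t s.
rewrite /dist metric_sym -/(dist s t) in h2.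
by rewrite ltr_norml; apply/andP; split; lra.
Qed.

(** Within distance [d] of [s], lower semicontinuity keeps [g] above [g s - eps]; beyond it, the
    penalty [n * d] exceeds [M >= g s] once [n >= M / d]. *)
Lemma lip_reg_cvg s :
  (forall c, c < g s -> \forall t \near s, c < g t) ->
  lip_reg n s @[n --> \oo] --> g s.
Proof.
move=> gs; apply/cvgrPdist_le => eps eps0.
have [d d0 dU] := nbhs_embedding (gs (g s - eps) (ltac:(rewrite ltrBlDr ltrDl//))).
have M0 : 0 <= M by have /andP[g0 gM] := g0M s; exact: le_trans gM.
have [N NM] : exists N : nat, M / d <= N%:R.
  by exists (Num.bound (M / d)); apply/ltW/archi_boundP; rewrite divr_ge0// ltW.
exists N => // n /= Nn.
have /andP[_ h2] := lip_reg_itv n s.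
rewrite ger0_norm ?subr_ge0// lerBlDr addrC -lerBlDr.
apply: le_lip_reg => t.
have /andP[gt0 _] := g0M t; have /andP[_ gsM] := g0M s.
have [st|st] := ltP (dist s t) d.
  by apply: (le_trans (ltW (dU t st))); rewrite lerDl mulr_ge0// mdist_ge0.
have : M <= n%:R * dist s t.
  rewrite -(divfK (lt0r_neq0 d0) M) ler_pM// ?(ltW d0)//.
    by rewrite divr_ge0 ?(ltW d0).
  by rewrite (le_trans NM)// ler_nat.
move=> hM; lra.
Qed.

End lipschitz_regularization.

(** * Semicontinuity of integrals under a Feller kernel *)

Lemma continuous_usc (R : realType) (X : topologicalType) (f : X -> R) :
  continuous f -> upper_semicontinuous f.
Proof. by move=> cf x c fxc; apply: cvgr_lt fxc; exact: cf. Qed.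

Section feller.
Context (R : realType) (S A : ptopologicalType).
Variables (K : set (S * A)) (q : S * A -> probability (borel S) R).
Hypotheses (hS : borel_space R S) (U3 : feller K q).

(** By monotone convergence some regularization already has integral above [c] at [x]; the Feller
    property preserves this nearby, and [g] dominates the regularization. *)
Lemma feller_lsc (g : S -> R) (M : R) :
  (forall s, 0 <= g s <= M) ->
  (forall s c, c < g s -> \forall t \near s, c < g t) ->
  forall x c, K x -> c < \int[q x]_(s in setT) g s ->
    \forall y \near within K (nbhs x), c < \int[q y]_(s in setT) g s.
Proof.
move=> g0M lg x c Kx cI.
have [X [e [_ _ _ eopen _]]] := hS.
pose h n := lip_reg e g n.
have ch n : continuous (h n) by apply: (lip_reg_continuous point eopen g0M).
have mh n : measurable_fun setT (h n : borel S -> R).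
  by apply: usc_measurable; exact: continuous_usc.
have h0g n s : 0 <= h n s <= g s by exact: (lip_reg_itv point e g0M).
have h0M n s : 0 <= h n s <= M.
  by have /andP[-> /le_trans] := h0g n s; apply; have /andP[] := g0M s.
have mu1 y : q y setT = 1%E by exact: probability_setT.
have [n cn] : exists n, c < \int[q x]_(s in setT) h n s.
  apply: contrapT => nex.
  suff : \int[q x]_(s in setT) g s <= c by rewrite leNgt cI.
  rewrite -lee_fin (RintegralK (mu1 x) (lexx 0) g0M).
  have := @cvg_monotone_convergence _ (borel S) R (q x) setT measurableT
    (fun n s => (h n s)%:E).
  rewrite (_ : (fun s => limn _) = (fun s => (g s)%:E)); last first.
    apply/funext => s; apply/cvg_lim => //; apply: cvg_EFin; first exact: nearW.
    by apply: (lip_reg_cvg point eopen g0M); exact: lg.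
  move=> cvgh; apply: (cvge_to_le (cvgh _ _ _)).
  - by move=> n; exact/measurable_EFinP.
  - by move=> n s _; rewrite lee_fin; have /andP[] := h0g n s.
  - by move=> s _ m n mn; rewrite lee_fin; exact: (lip_reg_nd point e g0M).
  apply: nearW => n.
  rewrite -(RintegralK (mu1 x) (lexx 0) (h0M n)) lee_fin leNgt.
  by apply/negP => ?; apply: nex; exists n.
have bh : bounded_fun (h n).
  exists M; split; first exact: num_real.
  move=> N MN s _ /=; have /andP[h0 hM] := h0M n s.
  by rewrite ger0_norm// (le_trans hM)// ltW.
have uI : usc_on K (fun y => - \int[q y]_(s in setT) h n s).
  have cI' : continuous ((fun y => \int[q y]_(s in setT) h n s) : subspace K -> R).
    exact: (U3 (ch n) bh).
  by apply/usc_on_subspace/continuous_usc => y; apply: cvgN; exact: cI'.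
move: (uI x (- c) Kx).
rewrite ltrN2 => /(_ cn); apply: filterS => y; rewrite ltrN2 => /lt_le_trans; apply.
apply: (@Rintegral_le _ _ _ _ (mu1 y) _ _ M) => s; last by have /andP[_] := g0M s.
- by have /andP[] := h0g n s.
- by have /andP[] := h0g n s.
Qed.

Variable (r : R).
Hypothesis r0 : r < 0.

Lemma certainty_equivalent_borel (v : S -> R) x : upper_semicontinuous v ->
  certainty_equivalent q r v x = r^-1 * ln (\int[q x]_(s in setT) expR (r * v s)).
Proof.
move=> /usc_measurable mv; rewrite /certainty_equivalent /Rintegral.
rewrite ge0_integral_completed//.
apply/measurable_EFinP; apply: measurableT_comp => //.
exact: measurable_funM.
Qed.

Lemma certainty_equivalent_usc (v : S -> R) (a b : R) :
  upper_semicontinuous v -> (forall s, a <= v s <= b) ->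
  usc_on K (certainty_equivalent q r v).
Proof.
move=> uv vab x c Kx.
have mu1 y : q y setT = 1%E by exact: probability_setT.
have E y : (certainty_equivalent q r v y < c) =
    (expR (r * c) < \int[q y]_(s in setT) expR (r * v s)).
  have I0 := Rintegral_expR_gt0 (mu1 y) r0 vab.
  rewrite certainty_equivalent_borel// mulrC ltr_ndivrMr//.
  by rewrite -[RHS]ltr_ln ?posrE ?expR_gt0// expRK mulrC.
rewrite E => cI; under eq_near do rewrite E.
apply: (@feller_lsc _ (expR (r * a))) => // s.
  by rewrite expR_ge0; have /andP[_] := expR_neg_itv r0 vab s.
move=> d ds.
(* Taking [ln d] is meaningful only for [d > 0]; otherwise positivity of the exponential
   suffices. *)
have [d0|d0] := leP d 0.
  by apply: nearW => t; apply: le_lt_trans (expR_gt0 _).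
have H y : (d < expR (r * v y)) = (v y < ln d / r).
  rewrite ltr_ndivlMr// (mulrC _ r) -[in RHS]ltr_expR lnK ?posrE//.
by rewrite H in ds; apply: filterS (uv s _ ds) => t; rewrite H.
Qed.

End feller.

(** * Upper semicontinuity is preserved by the Bellman operator *)

Section aggregate_usc.
Context (R : realType) (S A : ptopologicalType).
Variables (K : set (S * A)) (q : S * A -> probability (borel S) R).
Variables (u : S * A -> R) (b0 b1 beta r p eps B : R).
Hypotheses (hS : borel_space R S) (U3 : feller K q).
Hypothesis hsec : forall s, xsection K s !=set0.
Hypothesis hb0 : 0 < b0.
Hypothesis hub : forall x, K x -> b0 <= u x <= b1.
Hypotheses (hbeta : 0 <= beta < 1) (hr : r < 0) (hp0 : p != 0).
Hypotheses (heps : 0 < eps) (epsb0 : eps <= b0) (b1B : b1 <= B).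
Hypothesis U1c : forall s, compact (xsection K s).
Hypothesis U1u : usc_correspondence (fun s => xsection K s).
Hypothesis U2 : upper_semicontinuous (u : subspace K -> R).

(* By homogeneity a small common factor [t > 1] moves both arguments of the
   aggregator without reaching [c]. *)
Lemma aggregate_usc (v : S -> R) :
  upper_semicontinuous v -> (forall s, eps <= v s <= B) ->
  usc_on K (aggregate q u beta r p v).
Proof.
move=> uv bv x c Kx ac.
have /andP[ge _] := aggregate_itv q hb0 hub hbeta hr hp0 heps epsb0 b1B bv Kx.
set a := aggregate q u beta r p v x in ac ge.
have a0 : 0 < a := lt_le_trans heps ge.
(* The midpoint of 1 and [c / a], hence [1 < t] and [t * a < c]. *)
pose t := (1 + c / a) / 2.
have ca : 1 < c / a by rewrite ltr_pdivlMr// mul1r.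
have t1 : 1 < t by rewrite /t; lra.
have tac : t * a < c.
  rewrite /t (_ : _ * a = (a + c) / 2); first by lra.
  by field; rewrite gt_eqF.
have t0 : 0 < t by lra.
have u0 y : K y -> 0 < u y by move=> /hub/andP[h _]; exact: lt_le_trans h.
have ce0 y : 0 < certainty_equivalent q r v y.
  have /andP[h _] := certainty_equivalent_itv q hr y bv; exact: lt_le_trans h.
have nu : \forall y \near within K (nbhs x), u y < t * u x.
  by apply: (usc_on_subspace U2) => //; rewrite ltr_pMl// u0.
have nc : \forall y \near within K (nbhs x),
    certainty_equivalent q r v y < t * certainty_equivalent q r v x.
  by apply: (certainty_equivalent_usc hS U3 hr uv bv) => //; rewrite ltr_pMl.
have nK : \forall y \near within K (nbhs x), K y by exact: withinT.
have Eta : ces beta p (t * u x) (t * certainty_equivalent q r v x) = t * a.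
  exact: (cesM hp0 hbeta t0 (u0 _ Kx) (ce0 x)).
rewrite -Eta in tac.
near=> y; apply: le_lt_trans tac; apply: ces_le hp0 hbeta _ (ce0 y) _ _.
- by apply: u0; near: y.
- by apply: ltW; near: y.
- by apply: ltW; near: y.
Unshelve. all: by end_near. Qed.

Lemma bellman_op_usc (v : S -> R) :
  upper_semicontinuous v -> (forall s, eps <= v s <= B) ->
  upper_semicontinuous (bellman_op K q u beta r p v).
Proof.
move=> uv bv s0 c fc.
set f0 := bellman_op K q u beta r p v s0 in fc.
(* Strict bounds on the actions give only a weak bound on the supremum; the gap between [c'] and [c]
   restores strictness. *)
pose c' := (f0 + c) / 2.
have f0c' : f0 < c' by rewrite /c'; lra.
have c'c : c' < c by rewrite /c'; lra.
have fc' a : K (s0, a) -> aggregate q u beta r p v (s0, a) < c'.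
  move=> Ka; apply: le_lt_trans f0c'.
  exact: (aggregate_le_op q hsec hb0 hub hbeta hr hp0 heps epsb0 b1B bv Ka).
have := usc_section_lt (@U1c s0) U1u (aggregate_usc uv bv) fc'.
apply: filterS => s Hs; apply: le_lt_trans c'c; apply: bellman_op_le => // a Ka.
exact/ltW/Hs.
Qed.

End aggregate_usc.

(** * Existence and uniqueness of the solution *)

Theorem theorem3 (R : realType) (S A : ptopologicalType)
  (K : set (S * A)) (q : S * A -> probability (borel S) R)
  (u : S * A -> R) (b0 b1 beta r p eps B : R)
  (hS : borel_space R S) (hA : borel_space R A)
  (K0 : K !=set0) (hK : borel_set K)
  (hsec : forall s, xsection K s !=set0)
  (hq : transition_probability K q)
  (hu : measurable_fun (K : set (borel (S * A)%type)) (u : borel (S * A)%type -> R))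
  (hb0 : 0 < b0) (hb01 : b0 < b1)
  (hub : forall x, K x -> b0 <= u x <= b1)
  (hbeta : 0 <= beta < 1) (hr : r < 0) (hp : p < 1) (hp0 : p != 0)
  (heps : 0 < eps) (hepsB : eps < B)
  (hpneg : p < 0 -> eps <= b0 /\ (1 - beta) `^ p^-1 * b1 <= B)
  (hppos : 0 < p -> eps <= (1 - beta) `^ p^-1 * b0 /\ b1 <= B)
  (U1c : forall s, compact (xsection K s))
  (U1u : usc_correspondence (fun s => xsection K s))
  (U2 : upper_semicontinuous (u : subspace K -> R))
  (U3 : feller K q) :
  exists v : S -> R,
    [/\ usc_class eps B v,
        bellman_equation K q u beta r p v,
        usa_class eps B v &
        forall w : S -> R, usa_class eps B w ->
          bellman_equation K q u beta r p w -> w = v].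
Proof.
have beta1 : 0 < 1 - beta by case/andP: hbeta => _; rewrite subr_gt0.
have betale1 : 1 - beta <= 1 by case/andP: hbeta => h _; rewrite gerBl.
(* As [0 < 1 - beta <= 1], the constant [(1 - beta) ^ p^-1] is at least 1 for [p < 0] and at most 1
   for [p > 0]. *)
have [epsb0 b1B] : eps <= b0 /\ b1 <= B.
  have b10 : 0 < b1 by exact: lt_trans hb01.
  have [pn|pp|pz] := ltgtP p 0; last by rewrite pz eqxx in hp0.
  - have [? h] := hpneg pn; split => //; apply: le_trans h.
    have pV : p^-1 < 0 by rewrite invr_lt0.
    have := le_powR_neg pV beta1 betale1; rewrite powR1 => ?.
    by rewrite ler_peMl// ltW.
  - have [h ?] := hppos pp; split => //; apply: le_trans h _.
    have pV : 0 < p^-1 by rewrite invr_gt0.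
    have := le_powR_pos pV beta1 betale1; rewrite powR1 => ?.
    by rewrite ger_pMl.
have [th th01 hth] := ces_share_bound p hbeta hb0 (ltW hb01) heps (ltW hepsB).
pose Op := bellman_op K q u beta r p.
have Obox v : (forall s, eps <= v s <= B) -> forall s, eps <= Op v s <= B.
  exact: (bellman_op_box q hsec hb0 hub hbeta hr hp0 heps epsb0 b1B).
have Oscale := bellman_op_scale q hsec hb0 hub hbeta hr hp0 heps epsb0 b1B th01 hth.
pose v := iter_inf B Op.
have bv : forall s, eps <= v s <= B := iter_inf_box (ltW hepsB) Obox.
have fixv : Op v = v := iter_inf_fixed heps (ltW hepsB) hp0 th01 Obox Oscale.
have biter n s : eps <= iter n Op (cst B) s <= B.
  by elim: n s => [s|n IH]; [rewrite /= (ltW hepsB) lexx|exact: Obox].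
have uv : upper_semicontinuous v.
  apply: usc_inf => [n|s]; last first.
    by exists eps => _ [n _ <-]; have /andP[] := biter n s.
  elim: n => [x c /= Bc|n IH]; first exact: nearW.
  exact: (bellman_op_usc hS U3 hsec hb0 hub hbeta hr hp0 heps epsb0 b1B
    U1c U1u U2 IH (biter n)).
exists v; split.
- by [].
- exact/bellman_equationE.
- by split => //; exact: usc_upper_semianalytic.
- move=> w [_ bw] /bellman_equationE ww.
  exact: (box_fixed_point_unique heps (ltW hepsB) hp0 th01 Obox Oscale bw bv ww fixv).
Qed.
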